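(* Let $A$ be a Lebesgue measurable 3-sum-free subset of $[0,1]$ (i.e. there are no $x,y,z\in A$, not necessarily distinct, with $x+y=3z$) satisfying $\mu(A)=77/177$. Then there is an $i\in\{1,\dots,7\}$ such that $A\subset \mathcal{A}_i$.
   Context: $\mu$ denotes Lebesgue measure. Let $$\mathcal{A}_0=\left(\tfrac{8}{177},\tfrac{4}{59}\right)\cup\left(\tfrac{28}{177},\tfrac{14}{59}\right)\cup\left(\tfrac23,1\right).$$ The sets $\mathcal{A}_1,\dots,\mathcal{A}_7$ are the seven sets of the form $\mathcal{A}_0\cup\{p_1,p_2,p_3\}$, where $p_1\in\{8/177,4/59\}$, $p_2\in\{28/177,14/59\}$, $p_3\in\{2/3,1\}$ (one endpoint of each of the three intervals), excluding the choice $\{p_1,p_2,p_3\}=\{8/177,14/59,2/3\}$. *)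

(* Defs.v *)
From mathcomp Require Import all_boot all_algebra.
From mathcomp Require Import all_classical all_reals all_analysis.
Import GRing.Theory Num.Theory.
Local Open Scope classical_set_scope.
Local Open Scope ring_scope.

(* Lebesgue measurability: measurability w.r.t. the Caratheodory sigma-algebra of
   the Lebesgue outer measure, i.e. the sigma-algebra on which
   [completed_lebesgue_measure] (the Lebesgue measure) is defined. *)
Definition lebesgue_measurable {R : realType} (A : set R) : Prop :=
  (@wlength R idfun)^*%mu.-cara.-measurable A.

Definition sum_free3 {R : realType} (A : set R) : Prop :=
  forall x y z, A x -> A y -> A z -> x + y <> 3 * z.

Definition calA0 {R : realType} : set R :=
  `](8 / 177), (4 / 59)[ `|` `](28 / 177), (14 / 59)[ `|` `](2 / 3), 1[.

Definition calA {R : realType} (b1 b2 b3 : bool) : set R :=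
  calA0 `|` [set (if b1 then 4 / 59 else 8 / 177);
                 (if b2 then 14 / 59 else 28 / 177);
                 (if b3 then 1 else 2 / 3)].

(* The seven sets A_1..A_7: all endpoint choices except
   {p1,p2,p3} = {8/177, 14/59, 2/3}, i.e. (b1,b2,b3) = (false,true,false). *)
Definition admissible_choice (b1 b2 b3 : bool) : bool :=
  ~~ [&& ~~ b1, b2 & ~~ b3].

(* Main.v *)
(* Let F(t) be the measure of the part of A below t, and put a = inf A, s = sup A.
   Excluded sums give three kinds of inequalities: A misses (x + A)/3 and 3z - A
   for x, z in A, hence also, in measure, for x, z in the closure of A; and A + A
   misses 3A, where Freiman's bound |A + A| >= min (3|A|) (|A| + s - a) applies
   (it comes from Cauchy-Davenport in Z/N by covering compact sets with N cells).

   Let e be the measure of [2s/3, s] \ A.  The sumset bound makes e small, and then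
   |A n [s/3, 2s/3]| <= 2e/3 and |A n [2s/9 + a/3, s/3]| <= e/3, so that the part of
   A below 2s/9 + a/3 has measure at least |A| - s/3.  This applies twice: first to
   A, then to its part below b := sup (A n [0, 2s/9 + a/3]).  What remains lies in
   [a, 2b/9 + a/3], where it has measure at most b/9 - a/12 by the sumset bound.
   With |A| >= 77s/177 these linear inequalities force a = 8s/177, b = 42s/177 and
   equality everywhere, hence e = 0 at both levels, which fills the three intervals
   up to measure zero; a further point of A would meet one of the excluded sums. *)
Require Import Defs.
From mathcomp Require Import all_boot all_order all_algebra.
From mathcomp Require Import ring lra zify.
Import Order.TTheory GRing.Theory Num.Theory.
Local Open Scope ring_scope.
Set Implicit Arguments.
Unset Strict Implicit.
Unset Printing Implicit Defensive.

(** * Cauchy-Davenport *)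

Lemma Fp_shift_stable (p : nat) (A : {set 'F_p}) (h : 'F_p) :
  h != 0 -> (forall y, y \in A -> y + h \in A) ->
  A != set0 -> A = [set: 'F_p].
Proof.
move=> h0 stab /set0Pn[y yA].
have shift n : y + h *+ n \in A.
  by elim: n => [|n IHn]; rewrite ?mulr0n ?addr0// mulrSr addrA stab.
apply/setP => z; rewrite inE; have := shift (nat_of_ord ((z - y) / h)).
by rewrite -[h *+ _]mulr_natr natr_Zp mulrC divfK// addrC subrK.
Qed.

(* Davenport's transform: replacing (A, B) by (A :|: (B + x), B :&: (A - x))
   preserves #|A| + #|B| and does not enlarge A + B. *)
Lemma cauchy_davenport (p : nat) (A B C : {set 'F_p}) :
  prime p -> A != set0 -> B != set0 -> C != set0 ->
  (forall x y, x \in A -> y \in B -> x + y \notin C) ->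
  (#|A| + #|B| + #|C| <= p.+1)%N.
Proof.
move=> p_pr; have [n] := ubnP #|B|.
elim: n A B => // n IHn A B leBn A0 B0 C0 ABC.
have /set0Pn[b bB] := B0.
have ACp (b1 : 'F_p) : b1 \in B -> (#|A| + #|C| <= p)%N.
  move=> b1B; rewrite -(card_imset _ (addIr b1)) -[leqRHS](card_Fp p_pr) -cardsUI.
  rewrite (_ : _ :&: C = set0) ?cards0 ?addn0 ?max_card//.
  apply/setP => z; rewrite !inE; apply/negP => /andP[/imsetP[x xA ->]].
  by apply/negP/ABC.
have [B1|] := leqP #|B| 1; first by have := ACp b bB; lia.
move=> /card_gt1P[b1 [b2 [b1B b2B b12]]].
have [y yA yhA] : exists2 y, y \in A & y + (b2 - b1) \notin A.
  apply/exists_inP; rewrite -[X in is_true X]negbK; apply/negP.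
  rewrite negb_exists_in => /forall_inP stab.
  have AT : A = [set: 'F_p].
    apply: (@Fp_shift_stable _ _ (b2 - b1)) => //.
      by rewrite subr_eq0 eq_sym.
    by move=> y yA; have := stab y yA; rewrite negbK.
  have := ACp b bB; rewrite AT cardsT card_Fp// -[leqRHS]addn0 leq_add2l leqn0.
  by rewrite cards_eq0 (negPf C0).
(* This shift sends [b1] to [y], inside [A], and [b2] to [y + (b2 - b1)], outside [A]: so [B'] keeps
   [b1] and loses [b2]. *)
pose x := y - b1.
pose A' := A :|: [set z + x | z in B]; pose B' := B :&: [set z - x | z in A].
have inB' z : (z \in B') = (z \in B) && (z + x \in A).
  rewrite !inE; congr (_ && _); apply/imsetP/idP => [[w wA ->]|zA].
    by rewrite subrK.
  by exists (z + x) => //; rewrite addrK.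
have b1B' : b1 \in B' by rewrite inB' b1B /x addrC subrK.
have b2B' : b2 \notin B'.
  rewrite inB' b2B /= /x; apply: contra yhA.
  by rewrite (_ : b2 + (y - b1) = y + (b2 - b1)) // addrCA.
have ltB' : (#|B'| < #|B|)%N.
  apply: proper_card; apply/properP; split; first exact: subsetIl.
  by exists b2.
have cardE : (#|A'| + #|B'| = #|A| + #|B|)%N.
  rewrite -(card_imset (mem B) (addIr x)) -(cardsUI A); congr (_ + _)%N.
  rewrite -(card_imset (mem B') (addIr x)); apply: eq_card => z.
  rewrite [RHS]inE; apply/imsetP/andP => [[w]|[zA /imsetP[w wB zE]]].
    by rewrite inB' => /andP[wB wA] ->; split=> //; apply/imsetP; exists w.
  by exists w => //; rewrite inB' wB -zE.
rewrite -cardE; refine (IHn A' B' (leq_trans ltB' leBn) _ _ C0 _).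
- by apply/set0Pn; exists y; rewrite inE yA.
- by apply/set0Pn; exists b1.
move=> u v; rewrite inB' inE => /orP[uA|/imsetP[w wB ->]] /andP[vB vA].
  exact: ABC.
by rewrite -addrA (addrC x) addrC; apply: ABC.
Qed.

From mathcomp Require Import all_classical all_reals all_analysis.
From mathcomp Require Import measurable_realfun.
Import numFieldNormedType.Exports.
Local Open Scope classical_set_scope.

(** * Extremal problem for profiles *)

(* The inequalities below are those satisfied by the cumulative measure F of a
   3-sum-free set with closure C. *)
Record profile {R : realType} (C : set R) (F : R -> R) : Prop := Profile {
  profile_ge0 : forall u, 0 <= F u;
  profile_mono : forall u v, u <= v -> F u <= F v;
  profile_lip : forall u v, u <= v -> F v - F u <= v - u;
  profile_third : forall x u v, C x -> u <= v ->
    F ((x + v) / 3) - F ((x + u) / 3) + (F v - F u) / 3 <= (v - u) / 3;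
  profile_reflect : forall z u v, C z -> u <= v ->
    F (3 * z - u) - F (3 * z - v) + (F v - F u) <= v - u;
  profile_sumset : forall p q, C p -> C q -> p <= q ->
    3 * (F (2 / 3 * q) - F (2 / 3 * p)) + 3 * (F q - F p) <= 2 * (q - p) \/
    3 * (F (2 / 3 * q) - F (2 / 3 * p)) + (F q - F p) <= q - p;
  profile_inf : forall u v, F u < F v ->
    exists c, [/\ C c, u <= c, c <= v & F c = F u];
  profile_sup : forall u v, F u < F v ->
    exists c, [/\ C c, u <= c, c <= v & F c = F v] }.

(** The sumset bound on [[a, q]], with [F (2 / 3 * q) >= F q - q / 3]; its second alternative is the
    weaker one and gives the term [a / 4]. *)
Lemma profile_half {R : realType} (C : set R) (F : R -> R) (a q : R) :
  profile C F -> C a -> C q -> 0 <= a -> a <= q -> F a = 0 ->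
  F q <= q / 2 - a / 4.
Proof.
move=> pF Ca Cq a0 aq Fa.
have := @profile_mono _ _ _ pF (2 / 3 * a) a ltac:(lra).
have := @profile_lip _ _ _ pF (2 / 3 * q) q ltac:(lra).
by case: (profile_sumset pF Ca Cq aq); lra.
Qed.

Lemma profile_half0 {R : realType} (C : set R) (F : R -> R) (a t : R) :
  profile C F -> C a -> 0 <= a -> F a = 0 -> 0 <= t ->
  F t <= t / 2.
Proof.
move=> pF Ca a0 Fa t0.
have [Ft|Ft] := leP (F t) 0; first lra.
have [|c [Cc ac ct Fc]] := @profile_sup _ _ _ pF a t; first by rewrite Fa.
have := profile_half pF Ca Cc a0 ac Fa; lra.
Qed.

(** The two density hypotheses serve the two levels of the descent: the second for the whole set,
    the first for its part below [b]. Either one makes the measure [e] missing from [[2s/3, s]]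
    small enough. *)
Lemma profile_thirds {R : realType} (C : set R) (F : R -> R) (a s : R) :
  profile C F -> C a -> C s -> 0 <= a -> a <= s -> 0 < s -> F a = 0 ->
  27 * s - 9 * a <= 59 * F s \/ 77 * s <= 177 * F s ->
  [/\ a <= s / 3, F s - F (2 / 3 * s) <= s / 3,
      F (2 / 3 * s) - F (s / 3) <= 2 / 3 * (s / 3 - (F s - F (2 / 3 * s))) &
      F (s / 3) - F (2 / 9 * s + a / 3) <=
        (s / 3 - (F s - F (2 / 3 * s))) / 3].
Proof.
move=> pF Ca Cs a0 a_le_s s0 Fa dense.
have mono := profile_mono pF; have lip := profile_lip pF.
set d := F s in dense *.
pose e := s / 3 - (d - F (2 / 3 * s)).
have e0 : 0 <= e by have := lip (2 / 3 * s) s ltac:(lra); rewrite /e /d; lra.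
have F2a : F (2 / 3 * a) <= 0 by rewrite -Fa mono//; lra.
have ebound : e <= s - 2 * d - 2 / 3 * a \/ e <= (2 * s - 4 * d - a) / 3.
  rewrite /e; case: (profile_sumset pF Ca Cs a_le_s) => H.
    by left; rewrite /d in H *; lra.
  by right; rewrite /d in H *; lra.
have e6 : e < s / 6 by case: dense; case: ebound; lra.
have e34 : 3 / 4 * e < d - s / 3 by case: dense; case: ebound; lra.
have eE : F (2 / 3 * s) = d - s / 3 + e by rewrite /e; lra.
(* be = 2s/3 + g is the bottom of the part of the set above 2s/3 *)
have [|be [Cbe be1 be2 Fbe]] := @profile_inf _ _ _ pF (2 / 3 * s) s.
  by rewrite -/d eE; lra.
pose g := be - 2 / 3 * s.
have beE : be = 2 / 3 * s + g by rewrite /g; lra.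
have Fbe' : F be = d - s / 3 + e by rewrite Fbe.
have g0 : 0 <= g by rewrite /g; lra.
have ge : g <= e by have := lip be s be2; rewrite -/d; lra.
have U1 : F (2 / 3 * s) - F (4 / 9 * s) <= (e + g) / 3.
  have := lip (4 / 9 * s) (2 / 3 * be) ltac:(lra).
  by case: (profile_sumset pF Cbe Cs be2); rewrite -/d; lra.
have third x u : C x -> u <= s ->
    F ((x + s) / 3) - F ((x + u) / 3) <= (s - u - (d - F u)) / 3.
  by move=> Cx us; have := profile_third pF Cx us; rewrite -/d; lra.
have U2 : F (2 / 3 * s) - F (s / 3) <= 2 / 3 * e.
  have [Fle|Flt] := leP (F (4 / 9 * s)) (F (s / 3)); first by lra.
  have [w [Cw w1 w2 Fw]] := profile_inf pF Flt.
  (* The choice [u = 2 * w] makes [(w + u) / 3 = w], and [(w + s) / 3 >= 4 / 9 * s]. So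
     [F (4 / 9 * s) - F (s / 3)] is at most a third of what is missing from [[2 * w, s]]. *)
  have W1 := third w (2 * w) Cw ltac:(lra).
  have W2 := mono (4 / 9 * s) ((w + s) / 3) ltac:(lra).
  rewrite (_ : (w + 2 * w) / 3 = w) in W1; last by lra.
  (* If [be <= 2 * w], at most [e - g] is missing there, and [U1] completes the bound; the other
     case is contradictory. *)
  have [be_le|lt_be] := leP be (2 * w).
    by have := lip be (2 * w) be_le; lra.
  have F2w := mono (2 * w) be (ltW lt_be).
  (* Reflecting [[be, s]] by [3 * w - y] leaves the set at most [e - g] between [3 * w - s] and
     [3 * w - be]; below that, [W4] allows half the length. *)
  have W3 := profile_reflect pF Cw be2; rewrite -/d in W3.
  have W4 := profile_half0 pF Ca a0 Fa (ltac:(lra) : 0 <= 3 * w - s).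
  (* a linear combination of the bounds below gives d - s/3 <= 3/4 e *)
  exfalso; pose G := F (s / 3) - F (3 * w - be).
  have bound : d - s / 3 <= 5 / 6 * (w - s / 3) + 2 / 3 * (e - g) + G.
    by rewrite /G; lra.
  have [G0|G0] := leP G 0; first by lra.
  have lt_w : 3 * w - be < s / 3.
    by rewrite ltNge; apply/negP => /mono; rewrite /G in G0; lra.
  have G1 : G <= s / 3 - (3 * w - be) by apply: lip; lra.
  have a3 : a < s / 3.
    rewrite ltNge; apply/negP => /mono; rewrite Fa => Fs3.
    by have := profile_ge0 pF (3 * w - be); rewrite /G in G0; lra.
  (* A second bound on [G]: together with [V2], [F (s / 3) - F ((a + be) / 3)] is at most
     [(e - g) / 3]. *)
  have V1 := third a be Ca be2.
  have V2 := mono (s / 3) ((a + s) / 3) ltac:(lra).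
  have [ab|ab] := leP ((a + be) / 3) (3 * w - be).
    by have := mono _ _ ab; rewrite /G in bound G1; lra.
  have := lip _ _ (ltW ab); rewrite /G in bound G1.
  by case: dense; case: ebound; lra.
have a3 : a <= s / 3.
  rewrite leNgt; apply/negP => /ltW /mono; rewrite Fa; lra.
split => //; first by rewrite -/d; lra.
have := third a (2 / 3 * s) Ca ltac:(lra).
have := mono (s / 3) ((a + s) / 3) ltac:(lra).
rewrite (_ : (a + 2 / 3 * s) / 3 = 2 / 9 * s + a / 3); last by lra.
by rewrite -/d; lra.
Qed.

(** In units of [t], a 177th of the supremum, all thresholds become integers. Equality in the linear
    bounds fixes [a] and [b], and then the missing measure vanishes at both levels. *)
Lemma profile_extremal {R : realType} (C : set R) (F : R -> R) (a t : R) :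
  profile C F -> C a -> C (177 * t) -> 0 <= a -> a <= 177 * t -> 0 < t -> F a = 0 ->
  77 * t <= F (177 * t) ->
  [/\ a = 8 * t, F (12 * t) - F (8 * t) = 4 * t,
      F (42 * t) - F (28 * t) = 14 * t,
      F (177 * t) - F (118 * t) = 59 * t & F (177 * t) = 77 * t].
Proof.
move=> pF Ca Cs a0 a_le_s t0 Fa dense.
have mono := profile_mono pF; have lip := profile_lip pF.
have s0 : 0 < 177 * t by lra.
have dense1 : 77 * (177 * t) <= 177 * F (177 * t) by lra.
have [a3 T1 T2 T3] := profile_thirds pF Ca Cs a0 a_le_s s0 Fa (or_intror dense1).
rewrite (_ : 2 / 3 * (177 * t) = 118 * t) in T1 T2 T3; last by lra.
rewrite (_ : 177 * t / 3 = 59 * t) in a3 T1 T2 T3; last by lra.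
rewrite (_ : 2 / 9 * (177 * t) + a / 3 = (118 * t + a) / 3) in T3; last by lra.
clear Cs a_le_s dense1 s0.
have [|b [Cb ab bs Fb]] := @profile_sup _ _ _ pF a ((118 * t + a) / 3).
  by rewrite Fa; lra.
have b0 : 0 < b.
  have [//|b0] := ltP 0 b; have ba : b <= a by lra.
  by have := mono b a ba; lra.
(* Here [F b >= 18 * t] and [3 * b <= 118 * t + a], so [27 * b - 9 * a <= 1062 * t = 59 * (18 *
   t)]. *)
have dense' : 27 * b - 9 * a <= 59 * F b by lra.
have [a3' S1 S2 S3] :=
  profile_thirds pF Ca Cb a0 ab b0 Fa (or_introl dense').
have [|c [Cc ac cb Fc]] := @profile_sup _ _ _ pF a (2 / 9 * b + a / 3).
  by rewrite Fa; lra.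
have H1 := profile_half pF Ca Cc a0 ac Fa.
have H2 := lip _ _ ac.
(* With [F c >= 18 * t - b / 3] and [3 * b <= 118 * t + a], [H1] forces [a >= 8 * t] and [H2] forces
   [a <= 8 * t], so these bounds are all tight. *)
have aE : a = 8 * t by lra.
have bE : b = 42 * t by lra.
have cE : 2 / 9 * b + a / 3 = 12 * t by lra.
have F8 : F (8 * t) = 0 by rewrite -aE.
have F12 : F (12 * t) = 4 * t.
  by rewrite cE in S3 Fc; lra.
rewrite cE F12 in S3; rewrite (_ : (118 * t + a) / 3 = b) in T3 Fb; last by lra.
have F42 : 18 * t <= F (42 * t) by rewrite -bE; lra.
rewrite (_ : 2 / 3 * b = 28 * t) in S1 S2 S3; last by rewrite bE; lra.
rewrite (_ : b / 3 = 14 * t) in S1 S2 S3; last by rewrite bE; lra.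
rewrite bE in S1 S2 S3 T3.
clear dense' H1 H2 cE Fc Cc ac cb c a3' bs ab b0 Fb bE Cb Fa a3 Ca a0 b.
have slope1 x : 8 * t <= x -> x <= 12 * t -> F x = x - 8 * t.
  by move=> x1 x2; move: (lip _ _ x1) (lip _ _ x2); rewrite F8 F12; clear -x1; lra.
have F14 : F (14 * t) <= F (12 * t).
  rewrite leNgt; apply/negP => lt14.
  have [v [Cv v1 v2 Fv]] := profile_sup pF lt14.
  have v3 : 12 * t < v.
    by rewrite ltNge; apply/negP => /mono; rewrite Fv leNgt lt14.
  (* Both [[24 * t - v, 12 * t]] and its image under [y -> (v + y) / 3], which starts at [8 * t],
     lie in the full interval [[8 * t, 12 * t]]: too much measure. *)
  move: (@profile_third _ _ _ pF v (24 * t - v) (12 * t) Cv ltac:(lra)).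
  by clear -v1 v2 v3 slope1 t0; rewrite !slope1; lra.
have [F42E F28E] : F (42 * t) = 18 * t /\ F (28 * t) = 4 * t by split; lra.
clear S1 S2 S3 F42 F14.
have slope2 x : 28 * t <= x -> x <= 42 * t -> F x = x - 24 * t.
  by move=> x1 x2; move: (lip _ _ x1) (lip _ _ x2); rewrite F42E F28E; clear -x1; lra.
have F59 : F (59 * t) <= F (42 * t).
  rewrite leNgt; apply/negP => lt59.
  have [v [Cv v1 v2 Fv]] := profile_sup pF lt59.
  have v3 : 42 * t < v.
    by rewrite ltNge; apply/negP => /mono; rewrite Fv leNgt lt59.
  (* As before: [u >= 84 * t - v] puts [(v + u) / 3] above [28 * t], so [[u, 42 * t]] and its image
     both lie in a full interval. *)
  have [u [u1 u2 u3]] : exists u, [/\ 28 * t <= u, 84 * t - v <= u & u < 42 * t].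
    clear -v1 v2 v3 t0; have [vs|vs] := leP v (56 * t).
      by exists (84 * t - v); split; lra.
    by exists (28 * t); split; lra.
  move: (profile_third pF Cv (ltW u3)).
  by clear -v1 v2 v3 u1 u2 u3 slope2 t0; rewrite !slope2; lra.
by split; rewrite ?F42E ?F28E ?F12 ?F8; lra.
Qed.

(** * Points excluded by a full interval *)

Lemma profile_full_sub {R : realType} (C : set R) (F : R -> R) (p q u v : R) :
  profile C F -> F q - F p = q - p -> p <= u -> u <= v -> v <= q ->
  F v - F u = v - u.
Proof.
move=> pF full pu uv vq; have lip := profile_lip pF.
by have := lip _ _ pu; have := lip _ _ uv; have := lip _ _ vq; lra.
Qed.

(** Otherwise [(x + [p, q]) / 3] overlaps the full interval [[p, q]] in positive length; [[u, v]] is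
    the part of [[p, q]] that is mapped into it. *)
Lemma profile_full_third {R : realType} (C : set R) (F : R -> R) (p q x : R) :
  profile C F -> F q - F p = q - p -> p <= q -> C x ->
  x + q <= 3 * p \/ 3 * q <= x + p.
Proof.
move=> pF full pq Cx.
have [|lt1] := leP (x + q) (3 * p); first by left.
have [|lt2] := leP (3 * q) (x + p); first by right.
have p_lt_q : p < q by lra.
pose u := Num.max p (3 * p - x); pose v := Num.min q (3 * q - x).
have [u1 u2] : p <= u /\ 3 * p - x <= u by rewrite /u !le_max !lexx orbT.
have [v1 v2] : v <= q /\ v <= 3 * q - x by rewrite /v !ge_min !lexx orbT.
have uv : u < v by rewrite /u /v lt_min !gt_max; apply/andP; split; apply/andP; split; lra.
clearbody u v; have := profile_third pF Cx (ltW uv).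
rewrite (profile_full_sub pF full u1 (ltW uv) v1).
rewrite (@profile_full_sub _ _ _ p q ((x + u) / 3) ((x + v) / 3) pF full); lra.
Qed.

Lemma profile_full_reflect {R : realType} (C : set R) (F : R -> R) (p q x : R) :
  profile C F -> F q - F p = q - p -> p < q -> C x ->
  3 * x <= 2 * p \/ 2 * q <= 3 * x.
Proof.
move=> pF full pq Cx.
have [|lt1] := leP (3 * x) (2 * p); first by left.
have [|lt2] := leP (2 * q) (3 * x); first by right.
pose u := Num.max p (3 * x - q); pose v := Num.min q (3 * x - p).
have [u1 u2] : p <= u /\ 3 * x - q <= u by rewrite /u !le_max !lexx orbT.
have [v1 v2] : v <= q /\ v <= 3 * x - p by rewrite /v !ge_min !lexx orbT.
have uv : u < v by rewrite /u /v lt_min !gt_max; apply/andP; split; apply/andP; split; lra.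
clearbody u v; have := profile_reflect pF Cx (ltW uv).
rewrite (profile_full_sub pF full u1 (ltW uv) v1).
rewrite (@profile_full_sub _ _ _ p q (3 * x - v) (3 * x - u) pF full); lra.
Qed.

(** * Lebesgue measure and Freiman's inequality *)

Lemma measurable_affine {R : realType} (k c : R) :
  measurable_fun [set: R] (fun x => k * x + c).
Proof.
apply: continuous_measurable_fun => x.
by apply: cvgD; [apply: cvgMl_tmp; exact: cvg_id | exact: cvg_cst].
Qed.

Lemma measurable_preimage_affine {R : realType} (k c : R) (X : set R) :
  measurable X -> measurable ((fun x => k * x + c) @^-1` X).
Proof.
by move=> mX; rewrite -[_ @^-1` _]setTI; exact: measurable_affine.
Qed.

(** By uniqueness of Lebesgue measure it suffices to compare it with [|k|] times its push-forward on
    half-open intervals. *)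
Lemma lebesgue_measure_affine {R : realType} (k c : R) (X : set R) :
  k != 0 -> measurable X ->
  lebesgue_measure ((fun x => k * x + c) @^-1` X) =
    (`|k|^-1%:E * lebesgue_measure X)%E.
Proof.
move=> k0 mX.
pose g : measurableTypeR R -> measurableTypeR R := fun x => k * x + c.
have mg : measurable_fun setT g by exact: measurable_affine.
pose push :=
  measure_function_pushforward__canonical__measure_function_Measure
    lebesgue_measure mg.
pose nu := mscale (NngNum (normr_ge0 k)) push.
have main : lebesgue_measure X = nu X.
  apply: (@lebesgue_measure_unique R nu) => // _ [[a b]] _ <-.
  transitivity (`|k|%:E * lebesgue_measure (g @^-1` `]a, b]))%E => //=.
  rewrite (_ : g @^-1` _ = [set x | a < k * x + c <= b]); last first.
    by apply/seteqP; split=> x /=; rewrite in_itv.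
  have [k_gt0|k_lt0|k_eq0] := ltgtP 0 k; last by rewrite -k_eq0 eqxx in k0.
    rewrite (_ : [set x | a < k * x + c <= b] =
                 `](a - c) / k, (b - c) / k]%classic); last first.
      apply/seteqP; split=> x /=; rewrite in_itv/= ltr_pdivrMr// ler_pdivlMr//;
        by rewrite ltrBlDr lerBrDr mulrC.
    rewrite !lebesgue_measure_itv/= !lte_fin ltr_pM2r ?invr_gt0// ltrD2r.
    case: ifP => _; last by rewrite mule0.
    rewrite -!EFinB -EFinM gtr0_norm//; congr (_%:E); field; exact: lt0r_neq0.
  rewrite (_ : [set x | a < k * x + c <= b] = `[(b - c) / k, (a - c) / k[%classic); last first.
    apply/seteqP; split=> x /=; rewrite in_itv/= ler_ndivrMr// ltr_ndivlMr//;
      by rewrite ltrBlDr lerBrDr mulrC andbC.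
  rewrite !lebesgue_measure_itv/= !lte_fin ltr_nM2r ?invr_lt0// ltrD2r.
  case: ifP => _; last by rewrite mule0.
  rewrite -!EFinB -EFinM ltr0_norm//; congr (_%:E); field; exact: ltr0_neq0.
by rewrite main /nu /mscale/= /pushforward muleA -EFinM mulVf ?normr_eq0// mul1e.
Qed.

(* Junk value 0 on sets of infinite measure. *)
Definition len {R : realType} (X : set R) : R := fine (lebesgue_measure X).

Definition sub_itv {R : realType} (X : set R) (p q : R) :=
  measurable X /\ X `<=` `[p, q].

Lemma lebesgue_measure_len {R : realType} (X : set R) (p q : R) :
  sub_itv X p q -> lebesgue_measure X = (len X)%:E.
Proof.
move=> [mX Xpq]; rewrite /len fineK// fin_numElt; apply/andP; split.
  by rewrite (lt_le_trans _ (measure_ge0 _ _))// ltNyr.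
apply: (@le_lt_trans _ _ (lebesgue_measure `[p, q]%classic)).
  by apply: le_measure; rewrite ?inE//; exact: measurable_itv.
by rewrite lebesgue_measure_itv/=; case: ifP => _; rewrite -?EFinB ltry.
Qed.

Lemma len_ge0 {R : realType} (X : set R) : 0 <= len X.
Proof. by rewrite fine_ge0. Qed.

Lemma len_itv {R : realType} (p q : R) (b c : bool) : p <= q ->
  len [set` Interval (BSide b p) (BSide c q)] = q - p.
Proof.
move=> pq; rewrite /len lebesgue_measure_itv/= lte_fin.
case: ltP => // qp /=.
by have -> : p = q; [apply/eqP; rewrite eq_le pq qp | rewrite subrr].
Qed.

Lemma le_len {R : realType} (X Y : set R) (p q : R) :
  measurable X -> sub_itv Y p q -> X `<=` Y -> len X <= len Y.
Proof.
move=> mX [mY Ypq] XY.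
have sX : sub_itv X p q by split => // x /XY /Ypq.
rewrite -lee_fin -(lebesgue_measure_len sX) -(@lebesgue_measure_len _ Y p q)//.
by apply: le_measure; rewrite ?inE.
Qed.

Lemma lenU {R : realType} (X Y : set R) (p q : R) :
  sub_itv X p q -> sub_itv Y p q -> X `&` Y = set0 ->
  len (X `|` Y) = len X + len Y.
Proof.
move=> sX sY XY0; have sXY : sub_itv (X `|` Y) p q.
  case: sX sY => [mX Xpq] [mY Ypq]; split; first exact: measurableU.
  by move=> x [/Xpq|/Ypq].
apply: EFin_inj; rewrite EFinD -(lebesgue_measure_len sXY).
rewrite -(lebesgue_measure_len sX) -(lebesgue_measure_len sY).
by apply: measureU => //; [case: sX | case: sY].
Qed.

Lemma sub_itvS {R : realType} (X Y : set R) (p q : R) :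
  measurable X -> X `<=` Y -> sub_itv Y p q -> sub_itv X p q.
Proof. by move=> mX XY [_ Ypq]; split => // x /XY /Ypq. Qed.

Lemma lenUI {R : realType} (X Y : set R) (p q : R) :
  sub_itv X p q -> sub_itv Y p q ->
  len X + len Y = len (X `|` Y) + len (X `&` Y).
Proof.
move=> sX sY; have [mX _] := sX; have [mY _] := sY.
have sXY : sub_itv (X `&` Y) p q.
  by apply: sub_itvS sX; [exact: measurableI | exact: subIsetl].
have sYX : sub_itv (Y `\` X) p q.
  by apply: sub_itvS sY; [exact: measurableD | exact: subDsetl].
have -> : X `|` Y = X `|` (Y `\` X).
  by rewrite setDE setUIr setUv setIT.
rewrite (lenU sX sYX) ?setDIK// -{1}(setUIDK Y X) setIC (lenU sXY sYX).
  by rewrite (addrC (len (X `&` Y))) addrA.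
by apply/seteqP; split=> // x [[Xx _] [_]].
Qed.

Lemma len_disjoint {R : realType} (X Y : set R) (p q : R) : p <= q ->
  sub_itv X p q -> sub_itv Y p q -> X `&` Y = set0 ->
  len X + len Y <= q - p.
Proof.
move=> pq sX sY XY0; rewrite -(lenU sX sY XY0) -(len_itv true false pq).
have [mX Xpq] := sX; have [mY Ypq] := sY.
apply: (@le_len _ _ _ p q) => //; first exact: measurableU.
  by split => //; exact: measurable_itv.
by move=> x [/Xpq|/Ypq].
Qed.

Lemma len_affine {R : realType} (k c : R) (X : set R) : k != 0 -> measurable X ->
  len ((fun x => k * x + c) @^-1` X) = len X / `|k|.
Proof.
move=> k0 mX; rewrite /len lebesgue_measure_affine//.
have kinv : 0 < `|k|^-1 by rewrite invr_gt0 normr_gt0.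
have : (0 <= lebesgue_measure X)%E by exact: measure_ge0.
case: (lebesgue_measure X) => [r _|_|//].
- by rewrite -EFinM/= mulrC.
- by rewrite gt0_muley/= ?mul0r ?lte_fin.
Qed.

(** * Cumulative measure and affine images *)

Definition cumul {R : realType} (X : set R) (t : R) : R :=
  len (X `&` `]-oo, t]).

Lemma sub_itvI {R : realType} (X Y : set R) (p q : R) :
  sub_itv X p q -> measurable Y -> sub_itv (X `&` Y) p q.
Proof.
move=> sX mY; apply: (sub_itvS _ _ sX); last exact: subIsetl.
by case: sX => mX _; exact: measurableI.
Qed.

Lemma cumulB {R : realType} (X : set R) (p q u v : R) :
  sub_itv X p q -> u <= v -> cumul X v - cumul X u = len (X `&` `]u, v]).
Proof.
move=> sX uv; rewrite /cumul.
have -> : X `&` `]-oo, v] = (X `&` `]-oo, u]) `|` (X `&` `]u, v]).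
  rewrite -setIUr; congr (_ `&` _); apply/seteqP; split=> x /=; rewrite !in_itv/=.
    by move=> xv; rewrite xv andbT; case: (leP x u); [left | right].
  by move=> [xu|/andP[]//]; exact: le_trans uv.
rewrite (@lenU _ _ _ p q); first by rewrite addrAC subrr add0r.
- by apply: sub_itvI => //; exact: measurable_itv.
- by apply: sub_itvI => //; exact: measurable_itv.
- apply/seteqP; split=> // x [[_ /=]]; rewrite in_itv/= => xu [_ /=].
  by rewrite in_itv/= ltNge xu.
Qed.

Lemma len_set1 {R : realType} (x : R) : len [set x] = 0.
Proof. by rewrite /len lebesgue_measure_set1. Qed.

Lemma len0 {R : realType} : len (set0 : set R) = 0.
Proof. by rewrite /len measure0. Qed.

(** Common source of the third and reflection inequalities: the preimage of the part of [X] in []u,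
    v]] lies in [[p, q]], avoids [X], and has its length divided by [|k|]. *)
Lemma cumul_affine {R : realType} (X : set R) (a b k c p q u v : R) :
  sub_itv X a b -> k != 0 -> p <= q -> u <= v ->
  (forall x, u < k * x + c <= v -> p <= x <= q) ->
  (forall x, X x -> ~ X (k * x + c)) ->
  cumul X q - cumul X p + (cumul X v - cumul X u) / `|k| <= q - p.
Proof.
move=> sX k0 pq uv uvpq disj.
rewrite !(cumulB sX)// -(@len_affine _ k c)//; last first.
  by apply: measurableI; [case: sX | exact: measurable_itv].
apply: len_disjoint => //.
- split; first by apply: measurableI; [case: sX | exact: measurable_itv].
  by move=> x [_] /=; rewrite !in_itv/= => /andP[/ltW -> ->].
- split; first apply: measurable_preimage_affine.
    by apply: measurableI; [case: sX | exact: measurable_itv].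
  by move=> x /= [_]; rewrite !in_itv/=; exact: uvpq.
- by apply/seteqP; split=> // x [[/disj nX _] [/nX]].
Qed.

Lemma len_bigsetU {R : realType} (T : Type) (r : seq T) (f : T -> set R) (p q : R) :
  (forall i, sub_itv (f i) p q) ->
  sub_itv (\big[setU/set0]_(i <- r) f i) p q /\
  len (\big[setU/set0]_(i <- r) f i) <= \sum_(i <- r) len (f i).
Proof.
move=> sf; elim: r => [|i r [sr IHr]].
  by rewrite !big_nil len0; split => //; split => // x [].
have sU : sub_itv (f i `|` \big[setU/set0]_(j <- r) f j) p q.
  case: (sf i) sr => [mi Hi] [mr Hr]; split; first exact: measurableU.
  by move=> x [/Hi|/Hr].
rewrite !big_cons; split => //; apply: le_trans (lerD (lexx _) IHr).
by rewrite (lenUI (sf i) sr) lerDl len_ge0.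
Qed.

(** * Discretisation of a circle into a prime number of cells *)

Definition cell {R : realType} (c h : R) (n : nat) : set R :=
  `]c + n%:R * h, c + n.+1%:R * h].

(** Indices are taken in Z/N, so that adding them models addition of points modulo [N * h]. *)
Definition cells {R : realType} (N : nat) (c h : R) (X : set R) : {set 'F_N} :=
  [set i : 'F_N | `[< X `&` cell c h i !=set0 >]].

Lemma exists_cell {R : realType} (N : nat) (c h x : R) : 0 < h ->
  c < x <= c + N%:R * h -> exists2 n, (n < N)%N & cell c h n x.
Proof.
move=> h0 /andP[cx xN].
have ex : exists n : nat, x <= c + n%:R * h by exists N.
(* The least such number is nonzero because [c < x]; its predecessor is the index of the cell. *)
case: (ex_minnP ex) => -[|n] xn minn.
  by move: xn; rewrite mul0r addr0 leNgt cx.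
exists n; first exact: minn.
by rewrite /cell/= in_itv/= xn andbT ltNge; apply/negP => /minn; rewrite ltnn.
Qed.

Lemma len_cells {R : realType} (N : nat) (c h : R) (X : set R) :
  prime N -> 0 < h -> measurable X -> X `<=` `]c, c + N%:R * h] ->
  len X <= #|cells N c h X|%:R * h.
Proof.
move=> N_pr h0 mX XcN.
have cellS (i : 'F_N) : sub_itv (cell c h i) c (c + N%:R * h).
  split; first exact: measurable_itv.
  move=> x; rewrite /cell/= !in_itv/= => /andP[xi xi1].
  have iN : (i.+1 <= N)%N by rewrite -[leqRHS](Fp_cast N_pr) ltn_ord.
  rewrite (le_trans xi1) ?lerD2l ?ler_pM2r ?ler_nat// andbT.
  by apply/ltW/(le_lt_trans _ xi); rewrite lerDl mulr_ge0// ltW.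
have [sU lenU] := len_bigsetU (enum (cells N c h X)) cellS.
apply: (@le_trans _ _ (\sum_(i <- enum (cells N c h X)) len (cell c h i))).
  apply: le_trans lenU; apply: (le_len mX sU) => x Xx.
  have := XcN x Xx; rewrite /= in_itv/= => /(exists_cell h0)[n nN nx].
  rewrite -bigcup_seq; exists (n%:R : 'F_N) => /=.
    rewrite mem_enum inE; apply/asboolP; exists x; split => //.
    by rewrite val_Fp_nat// modn_small.
  by rewrite val_Fp_nat// modn_small.
rewrite big_enum/= (eq_bigr (fun=> h)) => [|i _].
  by rewrite sumr_const mulr_natl.
rewrite len_itv ?lerD2l ?ler_pM2r ?ler_nat//.
by rewrite -natr1; ring.
Qed.

Lemma closed_away {R : realType} (S : set R) (y : R) :
  closed S -> ~ S y -> exists2 e, 0 < e & forall s, S s -> e <= `|s - y|.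
Proof.
move=> /closed_openC oS nSy; have := open_nbhs_nbhs (conj oS nSy).
move=> /nbhs_ballP[e /= e0 eS]; exists e => // s Ss; rewrite leNgt.
by apply/negP => sy; apply: (eS s) => //; rewrite /ball/= distrC.
Qed.

Lemma compact_sum3 {R : realType} (A K : set R) : compact A -> compact K ->
  closed [set s | exists x y z, [/\ A x, A y, K z & s = x + y - z]].
Proof.
move=> cA cK; apply: compact_closed; first exact: Rhausdorff.
pose f (t : R * (R * R)) := t.1 + t.2.1 - t.2.2.
rewrite (_ : [set s | _] = f @` (A `*` (A `*` K))); last first.
  apply/seteqP; split=> [s [x [y [z [Ax Ay Kz ->]]]]|_ [[x [y z]] [Ax [Ay Kz]] <-]].
    by exists (x, (y, z)).
  by exists x, y, z.
apply: continuous_compact; last by do 2!apply: compact_setX => //.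
apply: continuous_subspaceT => t; apply: cvgB; last first.
  by apply: cvg_comp; [exact: cvg_snd | exact: cvg_snd].
apply: cvgD; first exact: cvg_fst.
by apply: cvg_comp; [exact: cvg_snd | exact: cvg_fst].
Qed.

(** If [x], [y], [z] lie in the cells [i], [j], [i + j], then [x + y - z] lies, up to [N * h],
    strictly between [- h] and [2 * h], against the distance [e]. So Cauchy-Davenport applies to the
    index sets; starting the cells of [K] at [2 * p] aligns the indices. *)
Lemma circle_cells {R : realType} (N : nat) (p h e : R) (A K : set R) :
  prime N -> 0 < h -> 2 * h <= e ->
  A !=set0 -> K !=set0 -> A `<=` `]p, p + N%:R * h] ->
  K `<=` `]2 * p, 2 * p + N%:R * h] ->
  (forall x y z, A x -> A y -> K z ->
    e <= `|x + y - z| /\ e <= `|x + y - z - N%:R * h|) ->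
  (2 * #|cells N p h A| + #|cells N (2 * p) h K| <= N.+1)%N.
Proof.
move=> N_pr h0 he A0 K0 Asub Ksub away.
have cells0 c (X : set R) : X !=set0 -> X `<=` `]c, c + N%:R * h] ->
    cells N c h X != finset.set0.
  move=> [x Xx] /(_ x Xx); rewrite /= in_itv/= => /(exists_cell h0)[n nN nx].
  apply/set0Pn; exists (n%:R : 'F_N); rewrite inE; apply/asboolP; exists x.
  by split => //; rewrite val_Fp_nat// modn_small.
rewrite mul2n -addnn.
refine (cauchy_davenport N_pr (cells0 _ _ A0 Asub) (cells0 _ _ A0 Asub)
  (cells0 _ _ K0 Ksub) _) => i j.
rewrite !inE => -[x [Ax xi]] [y [Ay yj]].
apply/negP => /asboolP[z [Kz]].
move: xi yj; rewrite /cell/= !in_itv/= => /andP[x1 x2] /andP[y1 y2] /andP[z1 z2].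
have [e0 e1] := away x y z Ax Ay Kz.
have ltN (l : 'F_N) : (l < N)%N by rewrite -[ltnRHS](Fp_cast N_pr) ltn_ord.
have sumE : nat_of_ord (i + j) = ((i + j) %% N)%N.
  transitivity ((i + j) %% (Zp_trunc (pdiv N)).+2)%N => //.
  by congr modn; exact: Fp_cast.
have succ (n : nat) : n.+1%:R * h = n%:R * h + h by rewrite -natr1 mulrDl mul1r.
rewrite succ in x2; rewrite succ in y2; rewrite succ in z2.
have [ltij|leij] := ltnP (i + j) N.
  rewrite modn_small// in sumE.
  have : (i + j)%R%:R * h = i%:R * h + j%:R * h by rewrite sumE natrD mulrDl.
  case: (ler0P (x + y - z)) e0; lra.
have : (i + j)%N%:R * h = (i + j)%R%:R * h + N%:R * h.
  rewrite -mulrDl -natrD; congr (_%:R * h).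
  rewrite sumE -[in RHS](subnK leij) modnDr modn_small ?subnK//.
  by have := ltN i; have := ltN j; lia.
rewrite natrD mulrDl.
case: (ler0P (x + y - z - N%:R * h)) e1; lra.
Qed.

(** Compactness keeps [A + A] at a positive distance from [K] modulo [q - p], so a prime number of
    short enough cells will do. The extra 1 in Cauchy-Davenport costs one cell length [h], which is
    arbitrarily small. *)
Lemma circle_compact {R : realType} (p q : R) (A K : set R) :
  p < q -> compact A -> compact K -> A !=set0 -> K !=set0 ->
  A `<=` `]p, q] -> K `<=` `]2 * p, p + q] ->
  (forall x y, A x -> A y -> ~ K (x + y) /\ ~ K (x + y - (q - p))) ->
  2 * len A + len K <= q - p.
Proof.
move=> pq cA cK A0 K0 Apq Kpq disj.
have cS := compact_sum3 cA cK.
have [|e e0 away0] := closed_away (y := 0) cS.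
  move=> [x [y [z [Ax Ay Kz /esym/eqP]]]]; rewrite subr_eq0 => /eqP xyz.
  by have [+ _] := disj x y Ax Ay; rewrite xyz.
have [|e' e'0 away1] := closed_away (y := q - p) cS.
  move=> [x [y [z [Ax Ay Kz xyz]]]].
  have [_] := disj x y Ax Ay; apply; rewrite (_ : _ - _ = z)//.
  by rewrite xyz; ring.
have mA : measurable A by exact: compact_measurable.
have mK : measurable K by exact: compact_measurable.
apply/ler_addgt0Pr => d d0.
pose m := Num.min d (Num.min (e / 2) (e' / 2)).
have m0 : 0 < m by rewrite /m !lt_min d0 !divr_gt0.
have [N ltN N_pr] := prime_above (Num.Def.archi_bound ((q - p) / m)).
pose h := (q - p) / N%:R.
have N0 : (0 : R) < N%:R by rewrite ltr0n prime_gt0.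
have h0 : 0 < h by rewrite divr_gt0// subr_gt0.
have Nh : N%:R * h = q - p by rewrite /h mulrCA divff ?mulr1// gt_eqF.
have hm : h <= m.
  rewrite /h ler_pdivrMr// mulrC -ler_pdivrMr//.
  have : 0 <= (q - p) / m by rewrite divr_ge0 ?subr_ge0 ?ltW.
  by move=> /archi_boundP/ltW/le_trans; apply; rewrite ler_nat ltnW.
have [me me'] : 2 * h <= e /\ 2 * h <= e'.
  have : m <= e / 2 /\ m <= e' / 2 by split; rewrite /m !ge_min lexx ?orbT.
  by case; lra.
have md : h <= d by apply: le_trans hm _; rewrite /m ge_min lexx.
have cardle : (2 * #|cells N p h A| + #|cells N (2 * p) h K| <= N.+1)%N.
  apply: (@circle_cells _ N p h (Num.min e e')) => //.
  - by rewrite le_min me me'.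
  - by rewrite Nh [p + _]addrC subrK.
  - by rewrite Nh (_ : 2 * p + (q - p) = p + q)//; ring.
  - move=> x y z Ax Ay Kz; rewrite Nh; split.
      rewrite ge_min -[x in `|x|]subr0 away0//; by exists x, y, z.
    by rewrite ge_min away1 ?orbT//; exists x, y, z.
have lenA := len_cells (c := p) N_pr h0 mA.
have lenK := len_cells (c := 2 * p) N_pr h0 mK.
rewrite Nh [p + _]addrC subrK in lenA.
rewrite Nh (_ : 2 * p + (q - p) = p + q) in lenK; last by ring.
move: cardle {lenA lenK}(lenA Apq) (lenK Kpq).
move: #|cells N p h A| #|cells N (2 * p) h K| => a k.
rewrite -(ler_nat R) -[N.+1]addn1 natrD natrM (natrD _ N) -(ler_pM2r h0) !mulrDl Nh.
lra.
Qed.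

Lemma inner_compact {R : realType} (X : set R) (p q e : R) :
  sub_itv X p q -> 0 < e ->
  exists V, [/\ compact V, V `<=` X & len X - e < len V].
Proof.
move=> sX e0; have [mX _] := sX.
have [|V [cV VX Ve]] := lebesgue_regularity_inner mX _ e0.
  change (lebesgue_measure X < +oo)%E.
  by rewrite (lebesgue_measure_len sX) ltry.
have mV : measurable V by exact: compact_measurable.
have sV : sub_itv V p q by apply: sub_itvS sX.
have sD : sub_itv (X `\` V) p q.
  by apply: (sub_itvS _ _ sX); [exact: measurableD | exact: subDsetl].
exists V; split => //; move: Ve.
change ((lebesgue_measure (X `\` V) < e%:E)%E -> len X - e < len V).
rewrite (lebesgue_measure_len sD) lte_fin.
have : len X = len V + len (X `\` V).
  by rewrite -(lenU sV sD) ?setDIK// setDUK.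
lra.
Qed.

Lemma len_gt0 {R : realType} (X : set R) : 0 < len X -> X !=set0.
Proof.
by move=> X0; apply/set0P/eqP => XE; rewrite XE len0 ltxx in X0.
Qed.

Lemma circle_measurable {R : realType} (p q : R) (A K : set R) :
  p < q -> measurable A -> measurable K -> 0 < len K ->
  A `<=` `]p, q] -> K `<=` `]2 * p, p + q] ->
  (forall x y, A x -> A y -> ~ K (x + y) /\ ~ K (x + y - (q - p))) ->
  2 * len A + len K <= q - p.
Proof.
move=> pq mA mK K0 Apq Kpq disj.
have sA : sub_itv A p q.
  by split => // x /Apq /=; rewrite !in_itv/= => /andP[/ltW -> ->].
have sK : sub_itv K (2 * p) (p + q).
  by split => // x /Kpq /=; rewrite !in_itv/= => /andP[/ltW -> ->].
have [A0|A0] := leP (len A) 0.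
  have : len K <= p + q - 2 * p.
    rewrite -(@len_itv _ (2 * p) (p + q) true false); last by lra.
    apply: (@le_len _ _ _ (2 * p) (p + q)) => //; last by case: sK.
    by split => //; exact: measurable_itv.
  lra.
apply/ler_addgt0Pr => e e0.
(* The loss [d] occurs three times, twice for [A] and once for [K]; [d <= len A] and [d <= len K]
   keep the compact parts nonempty. *)
pose d := Num.min (e / 3) (Num.min (len A) (len K)).
have d0 : 0 < d by rewrite /d !lt_min A0 K0 divr_gt0.
have [de dA dK] : [/\ d <= e / 3, d <= len A & d <= len K].
  by rewrite /d !ge_min !lexx !orbT.
have [VA [cVA VAA VAe]] := inner_compact sA d0.
have [VK [cVK VKK VKe]] := inner_compact sK d0.
have VA0 : VA !=set0 by apply: len_gt0; lra.
have VK0 : VK !=set0 by apply: len_gt0; lra.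
have := circle_compact pq cVA cVK VA0 VK0 (subset_trans VAA Apq)
  (subset_trans VKK Kpq).
have disjV x y : VA x -> VA y -> ~ VK (x + y) /\ ~ VK (x + y - (q - p)).
  by move=> /VAA Ax /VAA Ay; have [d1 d2] := disj x y Ax Ay; split=> /VKK.
by move=> /(_ disjV); lra.
Qed.

(* Freiman's 3k-3 theorem: |A + A| >= min (3 |A|) (|A| + (q - p)).  Since p and q
   are allowed as summands, A occupies residues modulo q - p that S misses twice. *)
Lemma sumset_bound {R : realType} (p q : R) (A S : set R) :
  p < q -> measurable A -> measurable S ->
  A `<=` `]p, q] -> S `<=` `]2 * p, 2 * q] ->
  (forall x, A x -> ~ S (x + p) /\ ~ S (x + q)) ->
  (forall x y, A x -> A y -> ~ S (x + y)) ->
  3 * len A + len S <= 2 * (q - p) \/ len A + len S <= q - p.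
Proof.
move=> pq mA mS Apq Spq endpts disj.
(* Folding modulo [q - p]: [T] is the lower half of [S], [T'] the upper half moved down, and [A'] is
   [A + p]. The sums with [p] and with [q] make [A'] disjoint from [T] and [T'] respectively. *)
pose T := S `&` `]2 * p, p + q].
pose T' := (fun t => 1 * t + (q - p)) @^-1` (S `&` `]p + q, 2 * q]).
pose A' := (fun t => 1 * t + - p) @^-1` A.
have subT : T `<=` `]2 * p, p + q] by move=> x [].
have subT' : T' `<=` `]2 * p, p + q].
  by move=> x [_ /=]; rewrite !in_itv/=; lra.
have subA' : A' `<=` `]2 * p, p + q].
  by move=> x /Apq /=; rewrite !in_itv/=; lra.
have sub X : measurable X -> X `<=` `]2 * p, p + q] -> sub_itv X (2 * p) (p + q).
  by move=> mX XS; split => // x /XS /=; rewrite !in_itv/= => /andP[/ltW -> ->].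
have mT : measurable T by apply: measurableI => //; exact: measurable_itv.
have mT' : measurable T'.
  by apply: measurable_preimage_affine; apply: measurableI => //; exact: measurable_itv.
have mA' : measurable A' by exact: measurable_preimage_affine.
have lenA' : len A' = len A by rewrite len_affine ?oner_eq0// normr1 divr1.
have lenT' : len T' = len (S `&` `]p + q, 2 * q]).
  rewrite len_affine ?oner_eq0// ?normr1 ?divr1//.
  by apply: measurableI => //; exact: measurable_itv.
have lenS : len S = len T + len T'.
  rewrite lenT' -(@lenU _ _ _ (2 * p) (2 * q)).
  - rewrite -setIUr -[LHS]/(len _); congr len; apply/seteqP; split=> x; last by case.
    move=> Sx; split => //; have /= := Spq x Sx; rewrite !in_itv/= => /andP[-> ->].
    by rewrite andbT; case: (leP x (p + q)); [left | right].
  - by split => // x [_] /=; rewrite !in_itv/=; lra.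
  - split; first by apply: measurableI => //; exact: measurable_itv.
    by move=> x [_] /=; rewrite !in_itv/=; lra.
  - apply/seteqP; split => // x [[_ /=] + [_ /=]]; rewrite !in_itv/=; lra.
have UI := lenUI (sub _ mT subT) (sub _ mT' subT').
have UA : len A' + len (T `|` T') <= p + q - 2 * p.
  apply: (@len_disjoint _ _ _ (2 * p) (p + q)); first lra.
  - exact: sub.
  - by apply: sub; [exact: measurableU | move=> x [/subT|/subT']].
  - apply/seteqP; split => // x [A'x]; have [e1 e2] := endpts _ A'x.
    case=> [[Sx _]|[Sx _]]; first by apply: e1; rewrite mul1r subrK.
    by apply: e2; move: Sx; rewrite (_ : 1 * x - p + q = 1 * x + (q - p)) //; ring.
rewrite lenA' in UA.
(* The intersection consists of the residues that [S] hits twice. If it is null, [UA] suffices;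
   otherwise the circle bound for it is added to [UA]. *)
have [K0|K0] := leP (len (T `&` T')) 0; first by right; lra.
left; suff : 2 * len A + len (T `&` T') <= q - p by lra.
apply: circle_measurable => //; first exact: measurableI.
- by move=> x [/subT].
- move=> x y Ax Ay; split=> -[[Sx _] [Sx' _]]; apply: (disj x y Ax Ay) => //.
  by move: Sx'; rewrite mul1r subrK.
Qed.

(** * Profiles of 3-sum-free sets *)

Lemma closure_distP {R : realType} (A : set R) (t : R) :
  closure A t <-> forall e, 0 < e -> exists2 x, A x & `|x - t| < e.
Proof.
split=> [clAt e e0|near B /nbhs_ballP[e /= e0 eB]].
  have [x [Ax]] := clAt _ (nbhsx_ballx t e e0).
  by rewrite /ball/= distrC; exists x.
by have [x Ax xt] := near e e0; exists x; split => //; apply: eB; rewrite /ball/= distrC.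
Qed.

Lemma cumul_mono {R : realType} (X : set R) (a b u v : R) :
  sub_itv X a b -> u <= v -> cumul X u <= cumul X v.
Proof. by move=> sX uv; rewrite -subr_ge0 (cumulB sX)// len_ge0. Qed.

Lemma cumul_lip {R : realType} (X : set R) (a b u v : R) :
  sub_itv X a b -> u <= v -> cumul X v - cumul X u <= v - u.
Proof.
move=> sX uv; rewrite (cumulB sX)// -(@len_itv _ u v false false)//.
apply: (@le_len _ _ _ u v).
- by apply: measurableI; [case: sX | exact: measurable_itv].
- split; first exact: measurable_itv.
  by move=> x /=; rewrite !in_itv/= => /andP[/ltW -> ->].
- exact: subIsetr.
Qed.

Lemma cumul_dist {R : realType} (X : set R) (a b u v e : R) :
  sub_itv X a b -> `|u - v| <= e -> `|cumul X u - cumul X v| <= e.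
Proof.
move=> sX; have [uv|vu] := leP u v.
  have := cumul_mono sX uv; have := cumul_lip sX uv.
  by rewrite !ler_norml; lra.
have := cumul_mono sX (ltW vu); have := cumul_lip sX (ltW vu).
by rewrite !ler_norml; lra.
Qed.

Lemma sum_free_third {R : realType} (A X : set R) (a b x u v : R) :
  sum_free3 A -> X `<=` A -> sub_itv X a b -> A x -> u <= v ->
  cumul X ((x + v) / 3) - cumul X ((x + u) / 3) + (cumul X v - cumul X u) / 3
    <= (v - u) / 3.
Proof.
move=> sfA XA sX Ax uv.
have := @cumul_affine _ X a b 3 (- x) ((x + u) / 3) ((x + v) / 3) u v sX.
rewrite (_ : (x + v) / 3 - (x + u) / 3 = (v - u) / 3); last by lra.
rewrite ger0_norm; last by lra.
apply; [lra|lra|exact: uv|by move=> y; lra|].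
move=> z /XA Az /XA Az'; apply: (sfA x (3 * z - x) z) => //.
by rewrite addrC subrK.
Qed.

Lemma sum_free_reflect {R : realType} (A X : set R) (a b z u v : R) :
  sum_free3 A -> X `<=` A -> sub_itv X a b -> A z -> u <= v ->
  cumul X (3 * z - u) - cumul X (3 * z - v) + (cumul X v - cumul X u) <= v - u.
Proof.
move=> sfA XA sX Az uv.
have := @cumul_affine _ X a b (-1) (3 * z) (3 * z - v) (3 * z - u) u v sX.
rewrite (_ : 3 * z - u - (3 * z - v) = v - u); last by lra.
rewrite normrN1 divr1.
apply; [lra|lra|exact: uv|by move=> y; lra|].
move=> y /XA Ay /XA Ay'; apply: (sfA (-1 * y + 3 * z) y z) => //.
by rewrite mulN1r addrAC addNr add0r.
Qed.

Lemma sum_free_sumset {R : realType} (A X : set R) (a b p q : R) :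
  sum_free3 A -> X `<=` A -> sub_itv X a b -> A p -> A q -> p < q ->
  3 * (cumul X (2 / 3 * q) - cumul X (2 / 3 * p)) +
    3 * (cumul X q - cumul X p) <= 2 * (q - p) \/
  3 * (cumul X (2 / 3 * q) - cumul X (2 / 3 * p)) +
    (cumul X q - cumul X p) <= q - p.
Proof.
move=> sfA XA sX Ap Aq pq; have [mX _] := sX.
have mI u v : measurable (X `&` `]u, v]).
  by apply: measurableI => //; exact: measurable_itv.
(* This is the dilate by 3 of a part of [X]; a sum of two points of [A] in it would solve
   [x + y = 3 * z]. *)
pose S := (fun s => 3^-1 * s + 0) @^-1` (X `&` `]2 / 3 * p, 2 / 3 * q]).
have SE : len S = 3 * len (X `&` `]2 / 3 * p, 2 / 3 * q]).
  rewrite len_affine// ?invr_eq0 ?pnatr_eq0// mulrC ger0_norm ?invr_ge0//.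
  by rewrite invrK.
rewrite (cumulB sX (ltW pq)) (cumulB sX (ltac:(lra) : 2 / 3 * p <= 2 / 3 * q)).
rewrite -SE; have sumA y z s : A y -> A z -> s = y + z -> ~ S s.
  move=> Ay Az -> [/XA Ayz _]; apply: (sfA y z _ Ay Az Ayz).
  by rewrite addr0 mulrA divff ?mul1r.
have [] := @sumset_bound _ p q (X `&` `]p, q]) S pq (mI _ _).
- exact: measurable_preimage_affine.
- by move=> x [].
- by move=> x [_ /=]; rewrite !in_itv/=; lra.
- by move=> x [/XA Ax _]; split; [apply: (sumA x p) | apply: (sumA x q)].
- by move=> x y [/XA Ax _] [/XA Ay _]; apply: (sumA x y).
- by left; lra.
- by right; lra.
Qed.

(** Measure is taken of [X], while the points come from [A]. The inequalities hold at points of [A]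
    and pass to the closure because [cumul X] is 1-Lipschitz. *)
Lemma sum_free_profile {R : realType} (A X : set R) (a b : R) :
  sum_free3 A -> X `<=` A -> sub_itv X a b -> profile (closure A) (cumul X).
Proof.
move=> sfA XA sX; split.
- by move=> u; exact: len_ge0.
- by move=> u v; exact: cumul_mono sX.
- by move=> u v; exact: cumul_lip sX.
- move=> x u v /closure_distP clx uv; apply/ler_addgt0Pr => e e0.
  have [y Ay yx] := clx e e0.
  have := sum_free_third sfA XA sX Ay uv.
  have : `|cumul X ((y + v) / 3) - cumul X ((x + v) / 3)| <= e / 3.
    by apply: (cumul_dist sX); move: yx; rewrite ltr_norml ler_norml; lra.
  have : `|cumul X ((y + u) / 3) - cumul X ((x + u) / 3)| <= e / 3.
    by apply: (cumul_dist sX); move: yx; rewrite ltr_norml ler_norml; lra.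
  by rewrite !ler_norml; lra.
- move=> z u v /closure_distP clz uv; apply/ler_addgt0Pr => e e0.
  have [y Ay yz] := clz (e / 6) ltac:(lra).
  have := sum_free_reflect sfA XA sX Ay uv.
  have : `|cumul X (3 * y - u) - cumul X (3 * z - u)| <= e / 2.
    by apply: (cumul_dist sX); move: yz; rewrite ltr_norml ler_norml; lra.
  have : `|cumul X (3 * y - v) - cumul X (3 * z - v)| <= e / 2.
    by apply: (cumul_dist sX); move: yz; rewrite ltr_norml ler_norml; lra.
  by rewrite !ler_norml; lra.
- move=> p q /closure_distP clp /closure_distP clq; rewrite le_eqVlt => /orP[/eqP <-|pq].
    by left; lra.
  have [|gt1] := leP; first by left.
  have [|gt2] := leP; first by right.
  exfalso; move: gt1 gt2; set D1 := 3 * _ + 3 * _; set D2 := 3 * _ + _.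
  (* If both alternatives fail, they fail by at least [e]. Moving [p] and [q] by less than [e / 20]
     changes either side too little to repair this, and [e <= q - p] keeps [p' < q']. *)
  move=> gt1 gt2; pose e := Num.min (D1 - 2 * (q - p)) (Num.min (D2 - (q - p)) (q - p)).
  have e0 : 0 < e by rewrite /e !lt_min !subr_gt0 gt1 gt2 pq.
  have [e1 e2 e3] : [/\ e <= D1 - 2 * (q - p), e <= D2 - (q - p) & e <= q - p].
    by rewrite /e !ge_min !lexx !orbT.
  have [p' Ap' pp'] := clp (e / 20) ltac:(lra).
  have [q' Aq' qq'] := clq (e / 20) ltac:(lra).
  have H1 : `|cumul X (2 / 3 * q') - cumul X (2 / 3 * q)| <= e / 20.
    by apply: (cumul_dist sX); move: qq'; rewrite ltr_norml ler_norml; lra.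
  have H2 : `|cumul X (2 / 3 * p') - cumul X (2 / 3 * p)| <= e / 20.
    by apply: (cumul_dist sX); move: pp'; rewrite ltr_norml ler_norml; lra.
  have H3 : `|cumul X q' - cumul X q| <= e / 20.
    by apply: (cumul_dist sX); move: qq'; rewrite ltr_norml ler_norml; lra.
  have H4 : `|cumul X p' - cumul X p| <= e / 20.
    by apply: (cumul_dist sX); move: pp'; rewrite ltr_norml ler_norml; lra.
  move: H1 H2 H3 H4 pp' qq'; rewrite !ler_norml !ltr_norml => H1 H2 H3 H4 pp' qq'.
  have p'q' : p' < q' by clearbody e; lra.
  rewrite /D1 /D2 in e1 e2; clearbody e; clear D1 D2 gt1 gt2.
  by have [] := sum_free_sumset sfA XA sX Ap' Aq' p'q'; lra.
- move=> u v ltF; have uv : u <= v.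
    by rewrite leNgt; apply/negP => /ltW/(cumul_mono sX); rewrite leNgt ltF.
  have : 0 < len (X `&` `]u, v]) by rewrite -(cumulB sX uv) subr_gt0.
  move=> /len_gt0 E0; set E := X `&` `]u, v] in E0.
  have Eu x : E x -> u <= x <= v by move=> [_ /=]; rewrite in_itv/= => /andP[/ltW -> ->].
  have lbE : has_inf E by split => //; exists u => x /Eu/andP[].
  have u_le : u <= inf E by apply: lb_le_inf => // x /Eu/andP[].
  have le_v : inf E <= v.
    have [x Ex] := E0; apply: (le_trans (ge_inf lbE.2 Ex)).
    by have /andP[] := Eu x Ex.
  exists (inf E); split => //.
    apply/closure_distP => e e0; have [x Ex xe] := inf_adherent e0 lbE.
    exists x; first by apply: XA; case: Ex.
    by have := ge_inf lbE.2 Ex; rewrite ltr_norml; lra.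
  (* [X] meets []u, inf E]] at most in the point [inf E], which is null. *)
  apply/eqP; rewrite eq_le (cumul_mono sX u_le) andbT -subr_le0 (cumulB sX u_le).
  rewrite -(len_set1 (inf E)); apply: (@le_len _ _ _ (inf E) (inf E)).
  + by apply: measurableI; [case: sX | exact: measurable_itv].
  + by split; [exact: measurable_set1 | move=> x ->; rewrite /= in_itv/= lexx].
  + move=> x [Xx /=]; rewrite in_itv/= => /andP[ux xi].
    apply/eqP; rewrite eq_le xi; apply: (ge_inf lbE.2).
    by split => //=; rewrite in_itv/= ux (le_trans xi).
- move=> u v ltF; have uv : u <= v.
    by rewrite leNgt; apply/negP => /ltW/(cumul_mono sX); rewrite leNgt ltF.
  have : 0 < len (X `&` `]u, v]) by rewrite -(cumulB sX uv) subr_gt0.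
  move=> /len_gt0 E0; set E := X `&` `]u, v] in E0.
  have Eu x : E x -> u <= x <= v by move=> [_ /=]; rewrite in_itv/= => /andP[/ltW -> ->].
  have ubE : has_sup E by split => //; exists v => x /Eu/andP[].
  have le_v : sup E <= v by apply: ge_sup => // x /Eu/andP[].
  have u_le : u <= sup E.
    have [x Ex] := E0; apply: (le_trans _ (ub_le_sup ubE.2 Ex)).
    by have /andP[] := Eu x Ex.
  exists (sup E); split => //.
    apply/closure_distP => e e0; have [x Ex xe] := sup_adherent e0 ubE.
    exists x; first by apply: XA; case: Ex.
    by have := ub_le_sup ubE.2 Ex; rewrite ltr_norml; lra.
  apply/eqP; rewrite eq_le (cumul_mono sX le_v)/= -subr_le0 (cumulB sX le_v).
  rewrite (_ : _ `&` _ = set0) ?len0//; apply/seteqP; split=> // x [Xx /=].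
  rewrite in_itv/= => /andP[xs xv].
  have : x <= sup E.
    by apply: (ub_le_sup ubE.2); split => //=; rewrite in_itv/= xv (le_lt_trans u_le).
  by rewrite leNgt xs.
Qed.

(** A set measurable for the completed measure is a Borel set together with a part of a Borel null
    set. *)
Lemma borel_part {R : realType} (A : set R) : lebesgue_measurable A ->
  exists X, [/\ measurable X, X `<=` A &
    lebesgue_measure X = completed_lebesgue_measure A].
Proof.
rewrite /lebesgue_measurable -completed_caratheodory_measurable.
rewrite g_sigma_completed_algebra_genE => -[X mX [N [B [mB B0 NB]] XNA]].
have XA : X `<=` A by rewrite -XNA; left.
exists X; split => //; apply/eqP; rewrite eq_le; apply/andP; split.
  exact: (@le_outer_measure _ _ ((@wlength R idfun)^*)%mu).
rewrite -XNA; apply: (le_trans (@outer_measureU2 _ _ ((@wlength R idfun)^*)%mu X N)).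
rewrite -[leRHS]adde0; apply: leeD => //; rewrite -B0.
exact: (@le_outer_measure _ _ ((@wlength R idfun)^*)%mu).
Qed.

(** * Location of the set and choice of the endpoints *)

Lemma sum_free_extremal {R : realType} (A : set R) :
  A `<=` `[0, 1] -> lebesgue_measurable A -> sum_free3 A ->
  completed_lebesgue_measure A = ((77 / 177)%:E)%E ->
  A `<=` [set x | [\/ 8 / 177 <= x <= 4 / 59, 28 / 177 <= x <= 14 / 59 |
                      2 / 3 <= x <= 1]].
Proof.
move=> A01 mA sfA muA x Ax.
have [X [mX XA muX]] := borel_part mA.
have sX : sub_itv X 0 1 by split => // y /XA /A01.
have lenX : len X = 77 / 177 by rewrite /len muX muA.
have pF := sum_free_profile sfA XA sX.
have A0 : A !=set0 by exists x.
have Ale y : A y -> 0 <= y <= 1 by move=> /A01; rewrite /= in_itv.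
have infA : has_inf A by split => //; exists 0 => y /Ale/andP[].
have supA : has_sup A by split => //; exists 1 => y /Ale/andP[].
have leinf y : A y -> inf A <= y by move=> Ay; exact: (ge_inf infA.2).
have lesup y : A y -> y <= sup A by move=> Ay; exact: (ub_le_sup supA.2).
have Ca : closure A (inf A).
  apply/closure_distP => e e0; have [y Ay ye] := inf_adherent e0 infA.
  by exists y => //; have := leinf y Ay; rewrite ltr_norml; lra.
have Cs : closure A (sup A).
  apply/closure_distP => e e0; have [y Ay ye] := sup_adherent e0 supA.
  by exists y => //; have := lesup y Ay; rewrite ltr_norml; lra.
have a0 : 0 <= inf A by apply: lb_le_inf => // y /Ale/andP[].
have as_ : inf A <= sup A by apply: (le_trans (leinf x Ax)); exact: lesup.
have s1 : sup A <= 1 by apply: ge_sup => // y /Ale/andP[].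
have Fa : cumul X (inf A) = 0.
  apply/eqP; rewrite eq_le len_ge0 andbT -(len_set1 (inf A)).
  apply: (@le_len _ _ _ (inf A) (inf A)).
  - by apply: measurableI => //; exact: measurable_itv.
  - by split; [exact: measurable_set1 | move=> y ->; rewrite /= in_itv/= lexx].
  - move=> y [/XA Ay /=]; rewrite in_itv/= => ya.
    by apply/eqP; rewrite eq_le ya leinf.
have Fs : cumul X (sup A) = 77 / 177.
  rewrite -lenX /cumul (_ : _ `&` _ = X)//; apply/seteqP; split=> y; first by case.
  by move=> Xy; split => //=; rewrite in_itv/= lesup//; exact: XA.
pose t := sup A / 177; have sE : sup A = 177 * t by rewrite /t; lra.
rewrite sE in Cs as_ s1 Fs; have lex := lesup x Ax; rewrite sE in lex.
have t0 : 0 < t.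
  have := cumul_lip sX as_; rewrite Fs Fa; have := a0; lra.
have [|aE E1 E2 E3 E4] := profile_extremal pF Ca Cs a0 as_ t0 Fa.
  by rewrite Fs; lra.
(* [E4] now reads [77 / 177 = 77 * t]; thus [sup A = 1]. *)
have tE : t = 1 / 177 by rewrite Fs in E4; lra.
have lea := leinf x Ax; rewrite aE in lea.
have Cx : closure A x by exact: subset_closure.
(* In units of [t], [H1] excludes the points between 12 and 28, [H2] those between 42 and 98, and
   [H3] those between 236/3 and 118; the last two ranges overlap and cover the gap from 42 to
   118. *)
have H1 := @profile_full_third _ _ _ (8 * t) (12 * t) x pF ltac:(lra) ltac:(lra) Cx.
have H2 := @profile_full_third _ _ _ (28 * t) (42 * t) x pF ltac:(lra) ltac:(lra) Cx.
have H3 := @profile_full_reflect _ _ _ (118 * t) (177 * t) x pF ltac:(lra) ltac:(lra) Cx.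
clear -tE lex lea H1 H2 H3; rewrite /=.
have [x12|x12] := leP x (12 * t); first by apply: Or31; lra.
have [x28|x28] := leP (28 * t) x; last by case: H1; lra.
have [x42|x42] := leP x (42 * t); first by apply: Or32; lra.
have [x118|x118] := leP (118 * t) x; first by apply: Or33; lra.
by case: H2; case: H3; lra.
Qed.

Theorem theorem1p2 (R : realType) (A : set R) :
  A `<=` `[0, 1] ->
  lebesgue_measurable A ->
  sum_free3 A ->
  completed_lebesgue_measure A = ((77 / 177)%:E)%E ->
  exists b1 b2 b3 : bool, admissible_choice b1 b2 b3 /\ A `<=` calA b1 b2 b3.
Proof.
move=> A01 mA sfA muA; have loc := sum_free_extremal A01 mA sfA muA.
(* Each of the three intervals has endpoints [p < q] with [2 * q = 3 * p], so [A] contains at most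
   one of them. *)
have clash p q : A p -> A q -> q + q = 3 * p -> False.
  by move=> Ap Aq; exact: (sfA q q p).
have split_end (p q r : R) (b : bool) : p <= r <= q -> (r = p -> ~~ b) -> (r = q -> b) ->
    (p < r < q) \/ r = if b then q else p.
  move=> /andP[pr rq] rp rq'; have [E|np] := eqVneq r p.
    by right; rewrite (negPf (rp E)).
  have [E|nq] := eqVneq r q; first by right; rewrite rq'.
  by left; rewrite !lt_neqAle [p == r]eq_sym np nq pr rq.
(* The defaults for endpoints outside [A] matter: the excluded choice arises only when 8/177, 14/59
   and 2/3 all lie in [A], which [8 + 118 = 3 * 42], in units of 1/177, forbids. *)
exists `[< ~ A (8 / 177) >], `[< A (14 / 59) >], `[< ~ A (2 / 3) >]; split.
  apply/negP => /and3P[/asboolPn/contrapT A8 /asboolP A42 /asboolPn/contrapT A118].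
  by have := sfA _ _ _ A8 A118 A42; apply; lra.
move=> x Ax; case: (loc x Ax) => xpq.
- have [||xi|->] := split_end _ _ _ `[< ~ A (8 / 177) >] xpq.
  + by move=> xE; apply/asboolPn; rewrite -xE.
  + by move=> xE; apply/asboolP => A8; apply: (clash _ _ A8 Ax); lra.
  + by left; left; left; rewrite /= in_itv.
  + by right; left; left.
- have [||xi|->] := split_end _ _ _ `[< A (14 / 59) >] xpq.
  + by move=> xE; apply/asboolPn => A42; apply: (clash _ _ Ax A42); lra.
  + by move=> xE; apply/asboolP; rewrite -xE.
  + by left; left; right; rewrite /= in_itv.
  + by right; left; right.
- have [||xi|->] := split_end _ _ _ `[< ~ A (2 / 3) >] xpq.
  + by move=> xE; apply/asboolPn; rewrite -xE.
  + by move=> xE; apply/asboolP => A118; apply: (clash _ _ A118 Ax); lra.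
  + by left; right; rewrite /= in_itv.
  + by right; right.
Qed.
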